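(* Let $H$ be a dag with $h$ vertices and $m$ edges which is not a rooted star. Then there exists $s(H)$ (namely the skewness of $H$) with $s(H)=m/2+O(m^{4/5}h^{1/5})$ and $s(H)<m$ such that the following holds for every $a^*>a(H)$: there is a constant $c^*=c^*(a^*,H)>0$ such that asymptotically almost surely $G\sim\vec G(n,n^{-1/a^*})$ has the property that for every set $X$ of at most $c^*\log n$ permutations of $V(G)$, there is an $H$-copy of $G$ such that for each $\pi\in X$, $G_L(\pi)$ contains at most $s(H)$ edges of that copy.
   Context: All graphs are simple finite directed graphs; $H$ has at least two edges and no isolated vertices. A dag is a directed graph with no directed cycle. $H$ is a rooted star if its underlying undirected graph is a star and the center is a source or a sink. The fractional arboricity is $a(H)=\max\{|E(H')|/(|V(H')|-1)\}$ over subgraphs $H'$ with at least two vertices. $\vec G(n,p)$ is the random digraph on $[n]$ with each ordered pair an edge independently with probability $p$; asymptotically almost surely means with probability $\to1$ as $n\to\infty$. For a digraph $G$ and permutation $\pi$ of $V(G)$, $G_L(\pi)$ is the spanning subgraph with edges $\{(i,j)\in E(G):\pi(i)<\pi(j)\}$. Skewness: for a vertex coloring $C$ of $H$, a permutation of $V(H)$ respects $C$ if the vertices of each color are consecutive; $s_H(C)=\max_\pi|E(H_L(\pi))|$ over permutations $\pi$ of $V(H)$ respecting $C$; $s(H)=\min_C s_H(C)$ over all vertex colorings $C$. The $O(\cdot)$ constant is absolute. Logarithms are base 2. *)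

(* Defs.v *)
From HB Require Import structures.
From mathcomp Require Import all_boot all_order all_fingroup all_algebra.
From mathcomp Require Import all_classical all_reals all_analysis.

Set Implicit Arguments.
Unset Strict Implicit.
Unset Printing Implicit Defensive.

Import Order.TTheory GRing.Theory Num.Theory.
Import numFieldNormedType.Exports.

Local Open Scope ring_scope.

(* Simple digraphs on the vertex set 'I_n: no loops and no multiple edges, but
   antiparallel pairs (i, j), (j, i) are allowed, as in the random digraph. *)
Record digraph (n : nat) := Digraph {
  edges :> {set 'I_n * 'I_n};
  digraph_loopless : [forall i, (i, i) \notin edges] }.

HB.instance Definition _ (n : nat) := [isSub for @edges n].
HB.instance Definition _ (n : nat) := [Finite of digraph n by <:].

Section Digraphs.
Variable n : nat.
Implicit Types (G : digraph n) (p : 'S_n).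

Definition edge G : rel 'I_n := [rel i j | (i, j) \in edges G].

(* With ucycle, directed cycles have pairwise distinct vertices; a pair of
   antiparallel edges is a directed cycle of length 2. *)
Definition dag G : Prop := forall c : seq 'I_n, ucycle (edge G) c -> c = [::].

Definition no_isolated G : Prop :=
  forall i, exists j, edge G i j || edge G j i.

Definition underlying G : rel 'I_n := [rel i j | edge G i j || edge G j i].

Definition star_centered (e : rel 'I_n) (c : 'I_n) : Prop :=
  forall i j, e i j = (i != j) && ((i == c) || (j == c)).

Definition source G (c : 'I_n) : Prop := forall i, ~~ edge G i c.
Definition sink G (c : 'I_n) : Prop := forall i, ~~ edge G c i.

Definition rooted_star G : Prop :=
  exists c, star_centered (underlying G) c /\ (source G c \/ sink G c).

(* A pair (vertex set, edge set). *)
Definition is_subgraph G (S : {set 'I_n} * {set 'I_n * 'I_n}) : bool :=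
  (S.2 \subset edges G) && (S.2 \subset finset.setX S.1 S.1).

(* All the ratios are nonnegative, so the default value 0 is harmless. *)
Definition arboricity (R : realType) G : R :=
  \big[Num.max/0]_(S : {set 'I_n} * {set 'I_n * 'I_n}
                  | is_subgraph G S && (2 <= #|S.1|)%N)
    (#|S.2|%:R / (#|S.1|%:R - 1)).

Lemma left_subgraph_subproof G p :
  [forall i, (i, i) \notin [set e in edges G | (p e.1 < p e.2)%N]%SET].
Proof. by apply/forallP => i; rewrite inE /= ltnn andbF. Qed.

(* p i is the position of vertex i. *)
Definition left_subgraph G p : digraph n := Digraph (left_subgraph_subproof G p).

(* A coloring is an arbitrary (not necessarily proper) map to n colors, which
   is enough to realize every partition of the vertices into color classes. *)
Definition respects (C : {ffun 'I_n -> 'I_n}) p : bool :=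
  [forall i, forall j, forall k,
     (p i < p j < p k)%N ==> (C i == C k) ==> (C j == C i)].

Definition skewness_col G (C : {ffun 'I_n -> 'I_n}) : nat :=
  (\max_(p : 'S_n | respects C p) #|edges (left_subgraph G p)|)%N.

(* The minimum is over all colorings; the identity coloring only witnesses
   that colorings exist. *)
Definition skewness G : nat :=
  skewness_col G
    [arg min_(C < [ffun i => i] : {ffun 'I_n -> 'I_n}) skewness_col G C]%N.

End Digraphs.

Section RandomDigraph.
Variables (R : realType) (n : nat).

Definition digraph_weight (q : R) (G : digraph n) : R :=
  \prod_(e : 'I_n * 'I_n | e.1 != e.2) (if e \in edges G then q else 1 - q).

Definition digraph_prob (q : R) (A : digraph n -> Prop) : R :=
  \sum_(G : digraph n | `[< A G >]) digraph_weight q G.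

End RandomDigraph.

Definition aas (R : realType) (q : nat -> R)
    (A : forall n : nat, digraph n -> Prop) : Prop :=
  (digraph_prob (q n) (A n) @[n --> \oo] --> (1 : R))%classic.

Section Copies.
Variables h n : nat.
Implicit Types (H : digraph h) (G : digraph n) (f : 'I_h -> 'I_n).

Definition copy_edges H f : {set 'I_n * 'I_n} :=
  [set (f e.1, f e.2) | e in edges H]%SET.

(* A copy is a not necessarily induced subgraph of G isomorphic to H, given by
   an embedding f; its edge set is copy_edges H f. *)
Definition is_copy H G f : Prop :=
  injective f /\ copy_edges H f \subset edges G.

End Copies.

Definition log2 (R : realType) (x : R) : R := ln x / ln 2.

Definition has_skew_copies (R : realType) (h : nat) (H : digraph h) (c : R)
    (n : nat) (G : digraph n) : Prop :=
  forall X : {set 'S_n}, #|X|%:R <= c * log2 (n%:R : R) ->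
  exists2 f : 'I_h -> 'I_n, is_copy H G f &
    forall p, p \in X ->
      (#|edges (left_subgraph G p) :&: copy_edges H f|%SET <= skewness H)%N.

(* Main.v *)
(* The probabilistic part reduces to a separation statement. In each permutation
   two vertex sets can be halved so that one half lies entirely before the other;
   iterating over all pairs of color classes of an optimal coloring and over all
   of the at most [c log n] permutations still leaves vertex blocks of size
   [N = n ^ (1 - eps)]. Every copy of [H] embedded along these blocks respects the
   coloring in every permutation, hence has at most [s(H)] edges pointing left to
   right. Janson's inequality makes the absence of such a copy in given blocks
   have probability at most [exp (- n ^ (1 + delta))], since
   [N ^ v p ^ e >= n ^ (1 + delta)] for all subgraphs of [H] with [v] vertices and
   [e > 0] edges as soon as [a > a(H)]; this beats the [2 ^ (n h)] choices of
   blocks.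

   For the size of [s(H)], a random coloring with about [(m / h) ^ (1 / 5)] colors
   has few monochromatic edges and is nearly balanced between any two colors, by a
   second moment computation. If [s(H) = m], suitable colorings show that any two
   edges of [H] share their tail or share their head, so that [H] is a rooted
   star. *)
Require Import Defs.
From mathcomp Require Import all_boot all_order all_fingroup all_algebra.
From mathcomp Require Import all_classical all_reals all_analysis.
From mathcomp Require Import ring lra zify.
From mathcomp.boot Require Import fintype finset.

Set Implicit Arguments.
Unset Strict Implicit.
Unset Printing Implicit Defensive.

Import Order.TTheory GRing.Theory Num.Theory.
Import numFieldNormedType.Exports.

Local Open Scope ring_scope.

(** * Harris and Janson inequalities *)

Section ProductMeasure.
Variables (R : realFieldType) (T : finType) (w : T -> R).

Definition expect (f : {set T} -> R) : R :=
  \sum_(S : {set T}) f S * \prod_e (if e \in S then w e else 1 - w e).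

Definition pweight (A : {set T}) : R := \prod_(e in A) w e.

Lemma expectD f g : expect (fun S => f S + g S) = expect f + expect g.
Proof. by rewrite -big_split /=; apply: eq_bigr => S _; rewrite mulrDl. Qed.

Lemma expectZ c f : expect (fun S => c * f S) = c * expect f.
Proof. by rewrite mulr_sumr; apply: eq_bigr => S _; rewrite mulrA. Qed.

Lemma expectN f : expect (fun S => - f S) = - expect f.
Proof. by rewrite -sumrN; apply: eq_bigr => S _; rewrite mulNr. Qed.

Lemma eq_expect f g : f =1 g -> expect f = expect g.
Proof. by move=> fg; apply: eq_bigr => S _; rewrite fg. Qed.

Lemma expect_sum (I : Type) (r : seq I) (P : pred I) (F : I -> {set T} -> R) :
  expect (fun S => \sum_(i <- r | P i) F i S) =
  \sum_(i <- r | P i) expect (F i).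
Proof.
by rewrite exchange_big /=; apply: eq_bigr => S _; rewrite mulr_suml.
Qed.

Lemma expect_cst c : expect (fun=> c) = c.
Proof.
rewrite /expect -mulr_sumr -[RHS]mulr1; congr (_ * _).
transitivity (\prod_e (w e + (1 - w e))); first by rewrite bigA_distr.
by apply: big1 => e _; rewrite addrC subrK.
Qed.

Lemma expect_split e f : expect f =
  \sum_(S : {set T} | e \notin S)
    (w e * f (e |: S) + (1 - w e) * f S) *
    \prod_(x | x != e) (if x \in S then w x else 1 - w x).
Proof.
rewrite /expect (bigID (fun S : {set T} => e \in S)) /=.
rewrite (reindex_onto (fun S => e |: S) (fun S => S :\ e)) /=; last first.
  by move=> S eS; rewrite setD1K.
rewrite (eq_bigl (fun S : {set T} => e \notin S)); last first.
  move=> S; rewrite setU11 /=; apply/eqP/idP => [<-|eS].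
    by rewrite !inE eqxx.
  by rewrite setU1K.
rewrite -big_split /=; apply: eq_bigr => S eS.
rewrite (bigD1 e) //= setU11 [X in _ + X](_ : _ = f S * ((1 - w e) *
  \prod_(x | x != e) (if x \in S then w x else 1 - w x))); last first.
  by rewrite (bigD1 e) //= (negPf eS).
rewrite (eq_bigr (fun x => if x \in S then w x else 1 - w x)); last first.
  by move=> x xe; rewrite !inE (negPf xe).
ring.
Qed.

Lemma expect_cond e f : expect f =
  w e * expect (fun S => f (e |: S)) + (1 - w e) * expect (fun S => f (S :\ e)).
Proof.
rewrite !(expect_split e) !mulr_sumr -big_split /=; apply: eq_bigr => S eS.
rewrite setUA setUid setU1K // (setDidPl _); last first.
  by rewrite disjoint_sym disjoints1.
ring.
Qed.

Lemma expect_subset (A : {set T}) g :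
  expect (fun S => (A \subset S)%:R * g S) =
  pweight A * expect (fun S => g (A :|: S)).
Proof.
rewrite /pweight; move: {2}#|A| (erefl #|A|) => k.
elim: k A g => [|k IH] A g cA.
  move/eqP: cA; rewrite cards_eq0 => /eqP ->; rewrite big_set0 mul1r.
  by apply: eq_expect => S; rewrite sub0set mul1r set0U.
have /set0Pn[e eA] : A != set0 by rewrite -cards_eq0 cA.
have cA' : #|A :\ e| = k by move: (cardsD1 e A); rewrite eA cA => -[].
rewrite (expect_cond e) [X in _ + X](_ : _ = 0) ?addr0; last first.
  rewrite -[X in (1 - w e) * X](_ : 0 = _) ?mulr0 // -[LHS](expect_cst 0).
  apply: eq_expect => S; rewrite [_ \subset _](negbTE _) ?mul0r //.
  by apply/subsetP => /(_ _ eA); rewrite !inE eqxx.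
rewrite (eq_expect (g := fun S => (A :\ e \subset S)%:R * g (e |: S))); last first.
  by by move=> S; rewrite subDset.
rewrite IH // (big_setD1 e eA) /= mulrA; congr (_ * _).
by apply: eq_expect => S; rewrite setUA setD1K.
Qed.

Hypothesis w01 : forall e, 0 <= w e <= 1.

Lemma le_expect f g : (forall S, f S <= g S) -> expect f <= expect g.
Proof.
move=> fg; apply: ler_sum => S _; apply: ler_wpM2r => //.
by apply: prodr_ge0 => e _; have := w01 e; case: ifP => _; lra.
Qed.

Lemma pweight_ge0 A : 0 <= pweight A.
Proof. by apply: prodr_ge0 => e _; case/andP: (w01 e). Qed.

Definition increasing_set (f : {set T} -> R) :=
  forall S S' : {set T}, S \subset S' -> f S <= f S'.

Lemma harris f g : increasing_set f -> increasing_set g ->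
  expect f * expect g <= expect (fun S => f S * g S).
Proof.
pose depends (D : {set T}) (u : {set T} -> R) := forall S, u S = u (S :&: D).
suff H k : forall (D : {set T}) u v, #|D| = k -> depends D u -> depends D v ->
    increasing_set u -> increasing_set v ->
    expect u * expect v <= expect (fun S => u S * v S).
  by move=> fi gi; apply: (H #|[set: T]| setT) => // S; rewrite setIT.
elim: k => [|k IH] D u v.
  move=> /eqP; rewrite cards_eq0 => /eqP -> du dv _ _.
  have -> : u = fun=> u set0 by apply: funext => S; rewrite du setI0.
  have -> : v = fun=> v set0 by apply: funext => S; rewrite dv setI0.
  by rewrite (expect_cst (u set0)) (expect_cst (v set0)) [leRHS](expect_cst (_ * _)).
move=> cD du dv iu iv.
have /set0Pn[e eD] : D != set0 by rewrite -cards_eq0 cD.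
have cD' : #|D :\ e| = k by move: (cardsD1 e D); rewrite eD cD => -[].
have d1 z : depends D z -> depends (D :\ e) (fun S => z (e |: S)).
  move=> dz S; rewrite dz [RHS]dz; congr z; apply/setP => x; rewrite !inE.
  by case: eqVneq => //= _; case: (x \in D); rewrite ?andbT ?andbF.
have d0 z : depends D z -> depends (D :\ e) (fun S => z (S :\ e)).
  move=> dz S; rewrite dz [RHS]dz; congr z; apply/setP => x; rewrite !inE.
  by case: eqVneq => //= _; case: (x \in D); rewrite ?andbT ?andbF.
have i1 z : increasing_set z -> increasing_set (fun S => z (e |: S)).
  by move=> iz S S' SS'; apply: iz; apply: setUS.
have i0 z : increasing_set z -> increasing_set (fun S => z (S :\ e)).
  by move=> iz S S' SS'; apply: iz; apply: setSD.
have le01 z : increasing_set z ->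
    expect (fun S => z (S :\ e)) <= expect (fun S => z (e |: S)).
  move=> iz; apply: le_expect => S; apply: iz.
  exact: subset_trans (subsetDl _ _) (subsetUr _ _).
rewrite (expect_cond e u) (expect_cond e v) (expect_cond e (fun S => u S * v S)).
have := IH _ _ _ cD' (d1 _ du) (d1 _ dv) (i1 _ iu) (i1 _ iv).
have := IH _ _ _ cD' (d0 _ du) (d0 _ dv) (i0 _ iu) (i0 _ iv).
move: (le01 _ iu) (le01 _ iv) (w01 e).
set u0 := expect _; set u1 := expect _; set v0 := expect _; set v1 := expect _.
set a0 := expect _; set a1 := expect _.
move: (w e) => p leu lev /andP[p0 p1] h0 h1.
have : p * (u1 * v1) + (1 - p) * (u0 * v0) <= p * a1 + (1 - p) * a0.
  by apply: lerD; apply: ler_wpM2l => //; lra.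
apply: le_trans; rewrite -subr_ge0.
rewrite (_ : _ - _ = p * (1 - p) * ((u1 - u0) * (v1 - v0))); last by ring.
by apply: mulr_ge0; apply: mulr_ge0; lra.
Qed.

Lemma expect_subset1 (A : {set T}) : expect (fun S => (A \subset S)%:R) = pweight A.
Proof.
rewrite (eq_expect (g := fun S => (A \subset S)%:R * 1)); last first.
  by move=> S; rewrite mulr1.
by rewrite expect_subset expect_cst mulr1.
Qed.

Section Janson.
Variables (I : finType) (A : I -> {set T}).

Definition none (l : seq I) (S : {set T}) : bool := all (fun i => ~~ (A i \subset S)) l.

Definition meet (i j : I) : bool := ~~ [disjoint A i & A j].

Lemma none_decreasing l : increasing_set (fun S => - (none l S)%:R).
Proof.
move=> S S' SS'; rewrite lerN2 ler_nat; case E: (none l S') => //.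
rewrite /none in E *; rewrite (sub_all _ E) // => i; apply: contra => AS.
exact: subset_trans AS SS'.
Qed.

Lemma janson_step i l :
  expect (fun S => (none (i :: l) S)%:R) <=
  expect (fun S => (none l S)%:R) *
    (1 - (pweight (A i) - \sum_(j <- l | meet i j) pweight (A i :|: A j))).
Proof.
set l0 := [seq j <- l | ~~ meet i j].
set F := fun S => (none l0 S)%:R : R; set N := fun S => (none l S)%:R : R.
set b := _ - \sum_(_ <- _ | _) _.
have NF S : none l S -> none l0 S.
  by move=> /allP nl; apply/allP => j; rewrite mem_filter => /andP[_ /nl].
have stepE : expect (fun S => (none (i :: l) S)%:R) =
    expect N - expect (fun S => (A i \subset S)%:R * N S).
  rewrite -expectN -expectD; apply: eq_expect => S; rewrite /N /none /=.
  by case: (A i \subset S); rewrite ?mul1r ?mul0r /= ?subrr ?subr0.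
have lowb : b * expect F <= expect (fun S => (A i \subset S)%:R * N S).
  apply: (@le_trans _ _ (expect (fun S => (A i \subset S)%:R * F S) -
     expect (fun S => \sum_(j <- l | meet i j) (A i :|: A j \subset S)%:R * F S))).
    rewrite expect_sum mulrBl; apply: lerB.
      rewrite expect_subset (eq_expect (g := F)) // => S; congr (_%:R).
      congr (nat_of_bool _); rewrite /none.
      apply: eq_in_all => j; rewrite mem_filter negbK => /andP[dij _].
      congr (~~ _); apply/idP/idP => [/subsetP sj|sj].
        apply/subsetP => x xj; have := sj _ xj; rewrite inE => /orP[xi|//].
        by have := disjointFr dij xi; rewrite xj.
      exact: subset_trans sj (subsetUr _ _).
    rewrite mulr_suml; apply: ler_sum => j _.
    have inc : increasing_set (fun S => (A i :|: A j \subset S)%:R).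
      move=> S S' SS'; rewrite ler_nat; case E: (_ \subset S) => //.
      by rewrite (subset_trans E SS').
    have := harris inc (@none_decreasing l0).
    rewrite expect_subset1 expectN mulrN.
    rewrite [leRHS](eq_expect (g := fun S => - ((A i :|: A j \subset S)%:R * F S))).
      by rewrite expectN lerN2.
    by move=> S; rewrite mulrN.
  rewrite -expectN -expectD; apply: le_expect => S; rewrite /N /F.
  case nl: (none l S).
    rewrite (NF _ nl) gerDl oppr_le0; apply: sumr_ge0 => j _.
    by apply: mulr_ge0; apply: ler0n.
  case nl0: (none l0 S); last by rewrite big1 ?mulr0 ?subr0 // => j _; rewrite mulr0.
  have [Ai|] := boolP (A i \subset S); last first.
    move=> Ai; rewrite !mul0r add0r oppr_le0; apply: sumr_ge0 => j _.
    by apply: mulr_ge0; apply: ler0n.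
  rewrite mulr0 mulr1 subr_le0.
  have /allPn[j jl] : ~~ none l S by rewrite nl.
  rewrite negbK => Aj.
  have mij : meet i j.
    apply: contraTT Aj => mij; have /allP/(_ j) := nl0.
    by rewrite mem_filter mij jl => /(_ isT).
  rewrite (big_rem j) //= mij subUset Ai Aj mulr1 lerDl; apply: sumr_ge0 => k _.
  by apply: mulr_ge0; apply: ler0n.
rewrite stepE mulrBr mulr1 lerB //.
have N0 : 0 <= expect N by rewrite -(expect_cst 0); apply: le_expect => S; apply: ler0n.
have [b0|/ltW b0] := leP 0 b.
  apply: le_trans lowb; rewrite mulrC ler_wpM2l //.
  by apply: le_expect => S; rewrite ler_nat; move: (NF S); case: (none l S) => // ->.
apply: (@le_trans _ _ 0); first by rewrite mulr_ge0_le0.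
rewrite -(expect_cst 0); apply: le_expect => S; apply: mulr_ge0; exact: ler0n.
Qed.

End Janson.
End ProductMeasure.

Lemma janson_seq (R : realType) (T : finType) (w : T -> R) (I : finType)
    (A : I -> {set T}) (l : seq I) : (forall e, 0 <= w e <= 1) -> uniq l ->
  expect w (fun S => (none A l S)%:R) <=
  expR (- (\sum_(i <- l) pweight w (A i) -
    \sum_(i <- l) \sum_(j <- l | (i != j) && meet A i j) pweight w (A i :|: A j))).
Proof.
move=> w01; elim: l => [|i l IH] /=.
  by move=> _; rewrite !big_nil subr0 oppr0 expR0 /none expect_cst.
move=> /andP[il ul]; apply: le_trans (janson_step w01 A i l) _.
set b := _ - \sum_(_ <- l | _) _.
apply: le_trans (_ : expect w (fun S => (none A l S)%:R) * expR (- b) <= _).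
  apply: ler_wpM2l; last exact: expR_ge1Dx.
  by rewrite -(expect_cst w 0); apply: le_expect => // S; apply: ler0n.
apply: le_trans (_ : _ * _ <= _).
  by apply: ler_wpM2r; [exact: expR_ge0 | exact: IH].
rewrite -expRD ler_expR -opprD lerN2 !big_cons eqxx /= {}/b.
have -> : \sum_(j <- l | (i != j) && meet A i j) pweight w (A i :|: A j) =
    \sum_(j <- l | meet A i j) pweight w (A i :|: A j).
  rewrite big_seq_cond [RHS]big_seq_cond; apply: eq_bigl => j.
  by case jl: (j \in l) => //=; move: (memPn il _ jl); rewrite eq_sym => ->.
have : \sum_(k <- l) \sum_(j <- l | (k != j) && meet A k j) pweight w (A k :|: A j)
  <= \sum_(k <- l) \sum_(j <- i :: l | (k != j) && meet A k j) pweight w (A k :|: A j).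
  apply: ler_sum => k _; rewrite big_cons; case: ifP => // _.
  by rewrite lerDr pweight_ge0.
lra.
Qed.

(* Restricting to a random set of indices, kept with probability [s], trades
   the first-order term [mu] for [s * mu] and [Delta] for [s ^ 2 * Delta]. *)
Lemma janson (R : realType) (T : finType) (w : T -> R) (I : finType)
    (A : I -> {set T}) (s : R) : (forall e, 0 <= w e <= 1) -> 0 <= s <= 1 ->
  expect w (fun S => [forall i, ~~ (A i \subset S)]%:R) <=
  expR (- (s * \sum_i pweight w (A i) -
    s ^+ 2 * \sum_i \sum_(j | meet A i j) pweight w (A i :|: A j))).
Proof.
move=> w01 s01; set Delta := \sum_i \sum_(_ | _) _; set mu := \sum_i _.
pose val (J : {set I}) := \sum_i (i \in J)%:R * pweight w (A i) -
  \sum_i \sum_(j | (i != j) && meet A i j) ([set i; j] \subset J)%:R * pweight w (A i :|: A j).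
have pw1 (i : I) : expect (fun=> s) (fun J : {set I} => (i \in J)%:R) = s.
  rewrite (eq_expect _ (g := fun J => ([set i] \subset J)%:R)).
    by rewrite expect_subset1 // /pweight big_set1.
  by move=> J; rewrite sub1set.
have Eval : s * mu - s ^+ 2 * Delta <= expect (fun=> s) val.
  rewrite expectD expectN !expect_sum; apply: lerB.
    rewrite mulr_sumr; apply: ler_sum => i _.
    rewrite (eq_expect _ (g := fun J => pweight w (A i) * (i \in J)%:R)).
      by rewrite expectZ pw1 mulrC.
    by move=> J; rewrite mulrC.
  rewrite mulr_sumr; apply: ler_sum => i _; rewrite expect_sum mulr_sumr.
  rewrite [leRHS](bigID (fun j => i != j)) /=.
  rewrite [X in _ <= X + _](eq_bigl (fun j => (i != j) && meet A i j)); last first.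
    by move=> j; rewrite andbC.
  rewrite -[leLHS]addr0; apply: lerD.
    apply: ler_sum => j /andP[ij _].
    rewrite (eq_expect _ (g := fun J => pweight w (A i :|: A j) * ([set i; j] \subset J)%:R)).
      by rewrite expectZ expect_subset1 // /pweight big_setU1 ?inE //= big_set1 mulrC.
    by move=> J; rewrite mulrC.
  apply: sumr_ge0 => j _; apply: mulr_ge0; last exact: pweight_ge0.
  by apply: exprn_ge0; case/andP: s01.
have [J leJ] : exists J, s * mu - s ^+ 2 * Delta <= val J.
  case: (arg_maxP val (erefl true : predT (set0 : {set I}))) => J _ maxJ.
  exists J; apply: le_trans Eval _; rewrite -[leRHS](expect_cst (fun _ : I => s)).
  by apply: le_expect => // J'; apply: maxJ.
apply: le_trans (_ : expect w (fun S => (none A (enum J) S)%:R) <= _).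
  apply: le_expect => // S; rewrite ler_nat.
  case: forallP => // nS; rewrite (_ : none _ _ _) //.
  by apply/allP => i _.
apply: le_trans (janson_seq A w01 (enum_uniq (mem J))) _.
rewrite ler_expR lerN2; apply: le_trans leJ _; rewrite /val.
have sumJ (F : I -> R) (P : pred I) :
    \sum_(i <- enum J | P i) F i = \sum_(i | P i) (i \in J)%:R * F i.
  rewrite big_enum_cond /= [RHS](bigID (mem J)) /= [X in _ + X]big1 ?addr0.
    by apply: eq_big => [i|i /andP[-> _]]; rewrite 1?andbC ?mul1r.
  by move=> i /andP[_ /negPf ->]; rewrite mul0r.
rewrite !sumJ; apply: lerB => //; apply: ler_sum => i _.
rewrite sumJ mulr_sumr; apply: ler_sum => j _.
by rewrite mulrA -natrM mulnb subUset !sub1set.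
Qed.

(** * Separated vertex blocks *)

Lemma perm_of_key h (g : 'I_h -> nat) : injective g ->
  exists r : 'S_h, forall i j, (r i < r j)%N = (g i < g j)%N.
Proof.
move=> gI; pose below i := [set j | (g j < g i)%N].
have belowS i j : (g i < g j)%N -> (#|below i| < #|below j|)%N.
  move=> ij; apply: proper_card; apply/properP; split.
    by apply/subsetP => k; rewrite !inE => /ltn_trans; apply.
  by exists i; rewrite !inE ?ltnn.
have belowP i : (#|below i| < h)%N.
  suff /proper_card : below i \proper [set: 'I_h] by rewrite cardsT card_ord.
  apply/properP; split; first exact: subsetT.
  by exists i; rewrite !inE ?ltnn.
have lt_below i j : (#|below i| < #|below j|)%N = (g i < g j)%N.
  case: (ltngtP (g i) (g j)) => [/belowS -> //|/belowS|/gI ->]; last exact: ltnn.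
  by move=> ji; apply/negbTE; rewrite -leqNgt ltnW.
have rI : injective (fun i => Ordinal (belowP i)).
  move=> i j /(congr1 val) /= eij; apply: gI.
  by case: (ltngtP (g i) (g j)) => // /belowS; rewrite eij ltnn.
by exists (perm rI) => i j; rewrite !permE /= lt_below.
Qed.

Definition before n (p : 'S_n) (A B : {set 'I_n}) : Prop :=
  forall x y, x \in A -> y \in B -> (p x < p y)%N.

Lemma prefix_of_size n (p : 'S_n) (A : {set 'I_n}) M : (M <= #|A|)%N ->
  exists k : nat, #|[set x in A | (p x < k)%N]| = M.
Proof.
move=> MA; pose pre k := [set x in A | (p x < k)%N].
have exk : exists k, (M <= #|pre k|)%N.
  exists n; rewrite (_ : pre n = A) //; apply/setP => x.
  by rewrite !inE ltn_ord andbT.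
case: (ex_minnP exk) => k Mk mink; exists k; apply/eqP; rewrite eqn_leq Mk andbT.
case: k => [|k] in Mk mink *.
  rewrite (_ : [set x in A | (p x < 0)%N] = set0) ?cards0 //.
  by apply/setP => x; rewrite !inE ltn0 andbF.
have prek : (#|pre k| < M)%N.
  by rewrite ltnNge; apply/negP => /mink; rewrite ltnn.
apply: leq_trans prek.
have sub : pre k.+1 \subset pre k :|: [set x | p x == k :> nat].
  apply/subsetP => x; rewrite !inE ltnS leq_eqVlt.
  by case: (x \in A); case: eqP => /=; rewrite ?orbT ?orbF.
apply: leq_trans (subset_leq_card sub) _.
apply: leq_trans (leq_card_setU _ _) _; rewrite -addn1 leq_add2l.
apply/card_le1_eqP => x y; rewrite !inE => /eqP px /eqP py.
by apply: (@perm_inj _ p); apply: val_inj; rewrite /= px py.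
Qed.

Lemma halve n (p : 'S_n) (A B : {set 'I_n}) M :
  (M * 2 <= #|A|)%N -> (M * 2 <= #|B|)%N ->
  exists A' B' : {set 'I_n}, [/\ A' \subset A, B' \subset B,
    (M <= #|A'|)%N, (M <= #|B'|)%N & before p A' B' \/ before p B' A'].
Proof.
wlog: A B / exists k l : nat, [/\ #|[set x in A | (p x < k)%N]| = M,
    #|[set x in B | (p x < l)%N]| = M & (k <= l)%N] => [wl MA MB|[k [l [Ak Bl kl]]] MA MB].
  have [k Ak] : exists k : nat, #|[set x in A | (p x < k)%N]| = M.
    by apply: prefix_of_size; lia.
  have [l Bl] : exists k : nat, #|[set x in B | (p x < k)%N]| = M.
    by apply: prefix_of_size; lia.
  have [kl|/ltnW lk] := leqP k l; first by apply: wl => //; exists k, l.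
  have [|B' [A' [BB AA cB cA sep]]] := wl B A _ MB MA; first by exists l, k.
  by exists A', B'; split=> //; case: sep; [right|left].
exists [set x in A | (p x < k)%N], (B :\: [set x in B | (p x < l)%N]); split.
- by apply/subsetP => x; rewrite inE => /andP[].
- exact: subsetDl.
- by rewrite Ak.
- have sub : [set x in B | (p x < l)%N] \subset B.
    by apply/subsetP => x; rewrite inE => /andP[].
  by rewrite cardsD (setIidPr sub) Bl; lia.
- left=> x y; rewrite !inE => /andP[_ xk] /andP[]; case: (y \in B) => //=.
  by rewrite -leqNgt => ly _; apply: leq_trans xk _; apply: leq_trans kl ly.
Qed.

Lemma separate (I : finType) n (L : seq (I * I * 'S_n)) M (U : I -> {set 'I_n}) :
  (forall i, (M * 2 ^ size L <= #|U i|)%N) ->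
  exists U' : I -> {set 'I_n},
    [/\ forall i, U' i \subset U i, forall i, (M <= #|U' i|)%N
      & forall i j p, (i, j, p) \in L -> i != j ->
          before p (U' i) (U' j) \/ before p (U' j) (U' i)].
Proof.
elim: L U => [|[[i j] p] L IH] U MU.
  by exists U; split=> // i; have := MU i; rewrite muln1.
have [U1 [sU1 MU1 sep1]] : exists U1 : I -> {set 'I_n},
    [/\ forall i, U1 i \subset U i, forall i, (M * 2 ^ size L <= #|U1 i|)%N
      & i != j -> before p (U1 i) (U1 j) \/ before p (U1 j) (U1 i)].
  have [ij|ij] := eqVneq i j.
    by exists U; split=> // k; apply: leq_trans (MU k); rewrite leq_mul2l leq_exp2l ?leqnSn ?orbT.
  have [||A [B [sA sB cA cB sep]]] := @halve n p (U i) (U j) (M * 2 ^ size L).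
  - by have := MU i; rewrite /= expnSr mulnA.
  - by have := MU j; rewrite /= expnSr mulnA.
  exists (fun k => if k == i then A else if k == j then B else U k); split.
  - by move=> k; case: eqP => [->|_] //; case: eqP => [->|_].
  - move=> k; case: eqP => [_|_] //; case: eqP => [_|_] //.
    by apply: leq_trans (MU k); rewrite leq_mul2l leq_exp2l ?leqnSn ?orbT.
  - by move=> _; rewrite !eqxx eq_sym (negPf ij).
have [U' [sU' MU' sep']] := IH U1 MU1.
exists U'; split=> [k||k l q].
- exact: subset_trans (sU' k) (sU1 k).
- exact: MU'.
rewrite inE => /orP[/eqP[-> -> ->]|] kl; last exact: sep'.
case: (sep1 kl) => [bf|bf]; [left|right] => x y xU yU;
  by apply: bf; [move: xU|move: yU]; apply/subsetP.
Qed.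

Lemma split_set (T : finType) h N (A : {set T}) : (h * N <= #|A|)%N ->
  exists V : nat -> {set T}, [/\ forall i, (i < h)%N -> V i \subset A,
    forall i, (i < h)%N -> #|V i| = N
    & forall i j, (i < h)%N -> (j < h)%N -> i != j -> [disjoint V i & V j]].
Proof.
elim: h A => [|h IH] A hA; first by exists (fun=> set0).
have /card_geqP[s [us ss sA]] : (N <= #|A|)%N by nia.
pose B := [set x in s].
have cB : #|B| = N by rewrite cardsE (card_uniqP us).
have BA : B \subset A by apply/subsetP => x; rewrite inE => /sA.
have [|V [sV cV dV]] := IH (A :\: B).
  by rewrite cardsD (setIidPr BA) cB; nia.
have dB i : (i < h)%N -> [disjoint B & V i].
  move=> /sV sVi; rewrite disjoint_sym.
  apply: disjointWl sVi _; rewrite disjoints_subset.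
  by apply/subsetP => x; rewrite !inE => /andP[].
exists (fun i => if i is i'.+1 then V i' else B); split.
- by case=> [|i] //= ih; apply: subset_trans (sV i ih) (subsetDl _ _).
- by case=> [|i] //= ih; apply: cV.
case=> [|i] [|j] //= ih jh ij; [exact: dB|rewrite disjoint_sym; exact: dB|].
exact: dV.
Qed.

Lemma separated_blocks h n N (C : 'I_h -> 'I_h) (X : {set 'S_n}) :
  (h * (h * N * 2 ^ (h * h * #|X|)) <= n)%N ->
  exists (U : 'I_h -> {set 'I_n}) (V : 'I_h -> {set 'I_n}),
    [/\ forall i, V i \subset U (C i), forall i, #|V i| = N,
        forall i j, i != j -> [disjoint V i & V j]
      & forall p c d, p \in X -> c != d ->
          before p (U c) (U d) \/ before p (U d) (U c)].
Proof.
move=> hn.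
have [|W [_ cW dW]] := @split_set 'I_n h (h * N * 2 ^ (h * h * #|X|)) [set: 'I_n].
  by rewrite cardsT card_ord.
pose L := enum (setX [set: 'I_h * 'I_h] X).
have sL : size L = (h * h * #|X|)%N.
  by rewrite -cardE cardsX cardsT card_prod card_ord.
have [|U [sU cU sep]] := @separate _ _ L (h * N) (fun c : 'I_h => W c).
  by move=> c; rewrite sL cW.
have dU c d : c != d -> [disjoint U c & U d].
  move=> cd; apply: disjointW (sU c) (sU d) _; exact: dW.
have /fin_all_exists[V VP] c := split_set (cU c).
exists U, (fun i => V (C i) i); split.
- by move=> i; have [sV _ _] := VP (C i); apply: sV.
- by move=> i; have [_ cV _] := VP (C i); apply: cV.
- move=> i j ij; have [sV _ dV] := VP (C i).
  have [Cij|Cij] := eqVneq (C i) (C j).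
    by rewrite -Cij; apply: dV.
  have [sV' _ _] := VP (C j).
  by apply: disjointW (sV i _) (sV' j _) (dU _ _ Cij).
- by move=> p c d pX cd; apply: sep => //; rewrite mem_enum !inE.
Qed.

Lemma copy_left_edges h n (H : digraph h) (C : {ffun 'I_h -> 'I_h}) (f : 'I_h -> 'I_n)
    (U : 'I_h -> {set 'I_n}) (p : 'S_n) (G : digraph n) :
  injective f -> (forall i, f i \in U (C i)) ->
  (forall c d, c != d -> before p (U c) (U d) \/ before p (U d) (U c)) ->
  (#|edges (left_subgraph G p) :&: copy_edges H f| <= skewness_col H C)%N.
Proof.
move=> fI fU sep.
have [r rP] := perm_of_key (inj_comp val_inj (inj_comp (@perm_inj _ p) fI)).
have rC : respects C r.
  apply/forallP => i; apply/forallP => j; apply/forallP => k.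
  rewrite !rP /=; apply/implyP => /andP[ij jk]; apply/implyP => /eqP Cik.
  apply: contraT => Cji; case: (sep _ _ Cji) => bf.
    by have := ltn_trans ij (bf _ _ (fU j) (fU i)); rewrite ltnn.
  have fk : f k \in U (C i) by rewrite Cik.
  by have := ltn_trans jk (bf _ _ fk (fU j)); rewrite ltnn.
apply: leq_trans (leq_bigmax_cond _ rC).
rewrite -(card_imset _ (_ : injective (fun e => (f e.1, f e.2)))).
  apply: subset_leq_card; apply/subsetP => e; rewrite !inE.
  case/andP => /andP[_ lt] /imsetP[e' e'H eE].
  by apply/imsetP; exists e' => //; rewrite !inE e'H rP /=; rewrite eE in lt.
by move=> [a b] [c d] [] /fI -> /fI ->.
Qed.

(** * Elementary bounds on the skewness *)

Section Skewness.
Variables (h : nat) (H : digraph h).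

Lemma edge_neq i j : edge H i j -> i != j.
Proof.
move=> ij; apply/eqP => eij; have /forallP/(_ i) := digraph_loopless H.
by rewrite {2}eij [_ \in _]ij.
Qed.

Lemma skewness_le C : (skewness H <= skewness_col H C)%N.
Proof. by rewrite /skewness; case: arg_minnP => // C0 _; apply. Qed.

Lemma respects_rev (C : {ffun 'I_h -> 'I_h}) : exists r r' : 'S_h,
  [/\ respects C r, respects C r' & forall i j, (r' i < r' j)%N = (r j < r i)%N].
Proof.
have keyI : injective (fun i : 'I_h => C i * h + i)%N.
  move=> i j /= /(congr1 (modn^~ h)).
  by rewrite !modnMDl !modn_small // => /val_inj.
have [r rP] := perm_of_key keyI.
have [r' r'P] : exists r' : 'S_h, forall i j, (r' i < r' j)%N = (r j < r i)%N.
  have [|r' r'P] := @perm_of_key h (fun i => h - r i)%N.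
    move=> i j eij; apply: (@perm_inj _ r); apply: val_inj => /=.
    by have := ltn_ord (r i); have := ltn_ord (r j); lia.
  exists r' => i j; rewrite r'P; have := ltn_ord (r i); have := ltn_ord (r j); lia.
have rC : respects C r.
  apply/forallP => i; apply/forallP => j; apply/forallP => k; rewrite !rP /=.
  apply/implyP => /andP[ij jk]; apply/implyP => /eqP Cik.
  rewrite -(inj_eq val_inj) /=; rewrite Cik in ij *.
  have := ltn_ord i; have := ltn_ord j; have := ltn_ord k.
  rewrite eqn_leq; case: (ltngtP (C j) (C k)) => //= jk'.
    by have : ((C j).+1 * h <= C k * h)%N; [rewrite leq_mul2r jk' orbT | rewrite mulSn; lia].
  by have : ((C k).+1 * h <= C j * h)%N; [rewrite leq_mul2r jk' orbT | rewrite mulSn; lia].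
exists r, r'; split=> //.
apply/forallP => i; apply/forallP => j; apply/forallP => k; rewrite !r'P.
apply/implyP => /andP[ij jk]; apply/implyP => /eqP Cik.
have /forallP/(_ k)/forallP/(_ j)/forallP/(_ i) := rC.
by rewrite jk ij Cik eqxx.
Qed.

Lemma skewness_ge : (#|edges H| <= 2 * skewness H)%N.
Proof.
rewrite /skewness; set C := [arg min_(C < _) _]%N.
have [r [r' [rC r'C r'P]]] := respects_rev C.
have le p : respects C p -> (#|edges (left_subgraph H p)| <= skewness_col H C)%N.
  by move=> pC; apply: (leq_bigmax_cond (F := fun p => #|edges (left_subgraph H p)|)).
rewrite mul2n -addnn; apply: leq_trans (leq_add (le _ rC) (le _ r'C)).
apply: leq_trans (leq_card_setU _ _); apply: subset_leq_card.
apply/subsetP => -[i j] eH; rewrite !inE /= eH r'P /= -neq_ltn.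
apply: contraNneq (edge_neq eH) => e.
by apply/eqP; apply: (@perm_inj _ r); apply: val_inj.
Qed.

Lemma skewness_lt : (2 <= #|edges H|)%N -> no_isolated H -> ~ rooted_star H ->
  (skewness H < #|edges H|)%N.
Proof.
move=> m2 iso nstar; rewrite ltnNge; apply/negP => mle.
have allC (C : {ffun 'I_h -> 'I_h}) : exists2 p : 'S_h, respects C p &
    forall i j, edge H i j -> (p i < p j)%N.
  have [|p pC pm] := @eq_bigmax_cond _ (respects C)
    (fun p => #|edges (left_subgraph H p)|).
    by have [r [_ [rC _ _]]] := respects_rev C; apply/card_gt0P; exists r.
  exists p => // i j ij.
  have eqL : edges (left_subgraph H p) = edges H.
    apply/eqP; rewrite eqEcard; apply/andP; split.
      by apply/subsetP => e; rewrite inE => /andP[].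
    by rewrite -pm; apply: leq_trans mle (skewness_le C).
  have : (i, j) \in edges (left_subgraph H p) by rewrite eqL.
  by rewrite inE => /andP[].
(* A coloring giving [u] and [y] one color and [v] and [x] another one prevents
   both edges from going left to right. *)
have share u v x y : edge H u v -> edge H x y -> x = u \/ y = v.
  move=> uv xy; have [->|xu] := eqVneq x u; first by left.
  have [->|yv] := eqVneq y v; first by right.
  have [p pC pE] := allC [ffun z => if (z == u) || (z == y) then u else v].
  have vu : v != u by rewrite eq_sym edge_neq.
  have xny := edge_neq xy.
  have npy : p v != p y :> nat.
    by rewrite (inj_eq val_inj) (inj_eq perm_inj) eq_sym.
  case: (ltngtP (p v) (p y)) npy => // pvy _.
    have /forallP/(_ u)/forallP/(_ v)/forallP/(_ y) := pC.
    rewrite pE // pvy !ffunE !eqxx orbT /= eqxx.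
    by rewrite [v == y]eq_sym (negPf vu) (negPf yv) /= (negPf vu).
  have /forallP/(_ x)/forallP/(_ y)/forallP/(_ v) := pC.
  rewrite pE // pvy !ffunE !eqxx orbT /= (negPf xu) (negPf xny) /=.
  by rewrite [v == y]eq_sym (negPf vu) (negPf yv) /= eqxx eq_sym (negPf vu).
have [e1 [e2 [e1H e2H e12]]] : exists e1 e2, [/\ e1 \in edges H, e2 \in edges H & e1 != e2].
  by have /card_gt1P[e1 [e2 [? ? ?]]] := m2; exists e1, e2.
case: e1 e2 e1H e2H e12 => [u v] [x y] uv xy.
have [xu|yv] := share _ _ _ _ uv xy.
  rewrite xu xpair_eqE eqxx /= => vy; apply: nstar; exists u.
  have src i j : edge H i j -> i = u.
    move=> ij; have [//|jv] := share _ _ _ _ uv ij.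
    have [//|jy] := share _ _ _ _ xy ij; first by rewrite xu.
    by rewrite -jv -jy eqxx in vy.
  split; last by left=> i; apply/negP => iu; have := edge_neq iu; rewrite (src _ _ iu) eqxx.
  move=> i j; rewrite /underlying /=; apply/idP/idP.
    case/orP => ij; rewrite (src _ _ ij) eqxx ?orbT andbT -(src _ _ ij).
      exact: edge_neq.
    by rewrite eq_sym edge_neq.
  case/andP => ij /orP[/eqP iu|/eqP ju].
    have [k /orP[jk|kj]] := iso j; first by rewrite iu (src _ _ jk) eqxx in ij.
    by have := kj; rewrite (src _ _ kj) -iu /edge /= => ->.
  have [k /orP[ik|ki]] := iso i; first by rewrite ju (src _ _ ik) eqxx in ij.
  by have := ki; rewrite (src _ _ ki) -ju /edge /= => ->; rewrite orbT.
rewrite yv xpair_eqE eqxx andbT => ux; apply: nstar; exists v.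
have snk i j : edge H i j -> j = v.
  move=> ij; have [iu|//] := share _ _ _ _ uv ij.
  have [ix|//] := share _ _ _ _ xy ij; last by rewrite yv.
  by rewrite -iu -ix eqxx in ux.
split; last by right=> i; apply/negP => vi; have := edge_neq vi; rewrite (snk _ _ vi) eqxx.
move=> i j; rewrite /underlying /=; apply/idP/idP.
  case/orP => ij; rewrite (snk _ _ ij) eqxx ?orbT andbT -(snk _ _ ij).
    exact: edge_neq.
  by rewrite eq_sym edge_neq.
case/andP => ij /orP[/eqP iv|/eqP jv].
  have [k /orP[jk|kj]] := iso j; last by rewrite iv (snk _ _ kj) eqxx in ij.
  by have := jk; rewrite (snk _ _ jk) -iv /edge /= => ->; rewrite orbT.
have [k /orP[ik|ki]] := iso i; last by rewrite jv (snk _ _ ki) eqxx in ij.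
by have := ik; rewrite (snk _ _ ik) -jv /edge /= => ->.
Qed.

End Skewness.

(** * Random colorings *)

Section RandomColoring.
Variables (R : realType) (h : nat) (H : digraph h).

Section FixedColoring.
Variables (K : finType) (C : 'I_h -> K).

Definition color_pair (e : 'I_h * 'I_h) : K * K := (C e.1, C e.2).

Definition swap (q : K * K) : K * K := (q.2, q.1).

Lemma swapK : involutive swap. Proof. by case. Qed.

Definition mono : nat := #|[set e in edges H | C e.1 == C e.2]|.

Definition signed (q : K * K) (e : 'I_h * 'I_h) : R :=
  (color_pair e == q)%:R - (color_pair e == swap q)%:R.

Definition imbalance (q : K * K) : R := \sum_(e in edges H) signed q e.

Lemma respects_between (C0 : {ffun 'I_h -> 'I_h}) (p : 'S_h) x y z :
  (forall i j, (C0 i == C0 j) = (C i == C j)) -> respects C0 p ->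
  (p x < p y < p z)%N -> C x = C z -> C y = C x.
Proof.
move=> C0C /forallP/(_ x)/forallP/(_ y)/forallP/(_ z) => + pxyz Cxz.
by rewrite pxyz !C0C Cxz eqxx /= => /eqP.
Qed.

Lemma left_edges_bound (C0 : {ffun 'I_h -> 'I_h}) (p : 'S_h) :
  (forall i j, (C0 i == C0 j) = (C i == C j)) -> respects C0 p ->
  2 * #|edges (left_subgraph H p)|%:R <=
    #|edges H|%:R + 2 * mono%:R + \sum_q `|imbalance q|.
Proof.
move=> C0C pC.
pose s (q : K * K) := (q.1 != q.2) &&
  [exists x, exists y, [&& C x == q.1, C y == q.2 & (p x < p y)%N]].
have s_asym q : s q -> s (swap q) -> False.
  case: q => i j /andP[/= ij /existsP[x /existsP[y /and3P[/eqP Cx /eqP Cy xy]]]].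
  case/andP => _ /existsP[y' /existsP[x' /and3P[/eqP Cy' /eqP Cx' yx']]].
  rewrite /= in Cy' Cx'.
  have [yx|xy'|e] := ltngtP (p y) (p x').
  - have := respects_between C0C pC (_ : p x < p y < p x')%N.
    rewrite xy yx Cx Cx' Cy => /(_ isT erefl) e; by rewrite e eqxx in ij.
  - have := respects_between C0C pC (_ : p y' < p x' < p y)%N.
    rewrite yx' xy' Cy' Cy Cx' => /(_ isT erefl) e; by rewrite e eqxx in ij.
  - have {}e : y = x' by apply: (@perm_inj _ p); apply: val_inj.
    by rewrite -Cx' -e Cy eqxx in ij.
pose cnt q : R := \sum_(e in edges H) (color_pair e == q)%:R.
have cnt_ge0 q : 0 <= cnt q by apply: sumr_ge0.
have imbE q : imbalance q = cnt q - cnt (swap q) by rewrite /imbalance sumrB.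
have sum_cnt (P : pred (K * K)) :
    \sum_(q | P q) cnt q = #|[set e in edges H | P (color_pair e)]|%:R.
  rewrite exchange_big /= -sum1_card natr_sum big_set big_mkcondr /=.
  apply: eq_bigr => e _; case: ifP => Pe.
    rewrite (bigD1 (color_pair e)) //= eqxx big1 ?addr0 // => q /andP[_].
    by rewrite eq_sym => /negPf ->.
  by rewrite big1 // => q Pq; case: eqP => // eq; rewrite -eq Pe in Pq.
have le1 : #|edges (left_subgraph H p)|%:R <= mono%:R + \sum_(q | s q) cnt q.
  rewrite sum_cnt -natrD ler_nat; apply: leq_trans (leq_card_setU _ _).
  apply: subset_leq_card; apply/subsetP => -[i j]; rewrite !inE /= => /andP[ij pij].
  rewrite ij /=; case: eqP => //= Cij; rewrite /s /=; apply/andP; split; first exact/eqP.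
  by apply/existsP; exists i; apply/existsP; exists j; rewrite !eqxx.
have le2 : \sum_(q | s q) cnt q + \sum_(q | s q) cnt (swap q) <= #|edges H|%:R.
  rewrite [X in _ + X](reindex_inj (inv_inj swapK)) /=.
  rewrite (eq_bigr _ (fun q _ => congr1 cnt (swapK q))).
  rewrite [leRHS](_ : _ = \sum_q cnt q); last first.
    by rewrite sum_cnt; congr (_%:R); apply: eq_card => e; rewrite inE andbT.
  rewrite [X in X + _]big_mkcond [X in _ + X]big_mkcond -big_split /=.
  apply: ler_sum => q _; have := s_asym q; case: (s q); case: (s (swap q)) => //=.
  - by move=> /(_ isT isT).
  - by rewrite addr0.
  - by rewrite add0r.
  - by rewrite addr0.
have le3 : \sum_(q | s q) imbalance q <= \sum_q `|imbalance q|.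
  rewrite [leRHS](bigID s) /= -[leLHS]addr0; apply: lerD; last exact: sumr_ge0.
  by apply: ler_sum => q _; exact: ler_norm.
have : \sum_(q | s q) imbalance q = \sum_(q | s q) cnt q - \sum_(q | s q) cnt (swap q).
  by rewrite -sumrB; apply: eq_bigr.
lra.
Qed.

End FixedColoring.

Section Average.
Variable k : nat.
Notation coloring := {ffun 'I_h -> 'I_k}.

Lemma sum_mono : (k * \sum_(C : coloring) mono C <= #|edges H| * #|{: coloring}|)%N.
Proof.
under eq_bigr do rewrite /mono -sum1_card big_set big_mkcondr /=.
rewrite exchange_big /= big_distrr /= -sum_nat_const; apply: leq_sum => -[u v] uv.
rewrite -big_mkcond sum1_card -[k in (k * _)%N](card_ord k) mulnC -cardX.
pose recolor (z : coloring * 'I_k) : coloring :=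
  [ffun x => if x == u then z.2 else z.1 x].
have vu : v != u by rewrite eq_sym; apply: edge_neq uv.
rewrite -(card_in_imset (f := recolor)); first exact: max_card.
move=> [C c] [D d] /=; rewrite !inE /= !andbT => /eqP/val_inj Cuv /eqP/val_inj Duv e.
have ec x : recolor (C, c) x = recolor (D, d) x by rewrite e.
have := ec u; rewrite !ffunE eqxx /= => ->; congr pair; apply/ffunP => x.
have := ec x; rewrite !ffunE /=; case: eqVneq => [-> _|//].
by rewrite Cuv Duv; have := ec v; rewrite !ffunE (negPf vu).
Qed.

Definition touch (e e' : 'I_h * 'I_h) : bool :=
  (e'.1 \in [set e.1; e.2]) || (e'.2 \in [set e.1; e.2]).

Lemma card_touch e : (#|[set e' | touch e e']| <= 4 * h)%N.
Proof.
have c2 : (#|[set e.1; e.2]| <= 2)%N by rewrite cards2; case: (_ == _).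
apply: leq_trans (_ : #|setX [set e.1; e.2] [set: 'I_h] :|:
                        setX [set: 'I_h] [set e.1; e.2]| <= _)%N.
  apply: subset_leq_card; apply/subsetP => -[a b].
  by rewrite /touch !inE /= ?andbT.
apply: leq_trans (leq_card_setU _ _) _; rewrite !cardsX cardsT card_ord.
apply: leq_trans (leq_add (leq_mul c2 (leqnn h)) (leq_mul (leqnn h) c2)) _; lia.
Qed.

Lemma signed_le1 (C : coloring) q e : `|signed C q e| <= 1.
Proof.
rewrite /signed; do 2! case: eqP => _;
by rewrite ?subrr ?subr0 ?sub0r ?normrN ?normr0 ?normr1.
Qed.

Lemma sum_signed (C : coloring) e : \sum_q `|signed C q e| <= 2.
Proof.
apply: le_trans (_ : \sum_q ((color_pair C e == q)%:R + (color_pair C e == swap q)%:R) <= _).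
  apply: ler_sum => q _; apply: le_trans (ler_normB _ _) _.
  by rewrite !ger0_norm.
have one (c : 'I_k * 'I_k) : \sum_q (c == q)%:R = 1 :> R.
  rewrite (bigD1 c) //= eqxx big1 ?addr0 // => q; rewrite eq_sym.
  by move=> /negPf ->.
rewrite big_split /= one [X in _ + X](reindex_inj (inv_inj (@swapK _))) /=.
by under [X in _ + X]eq_bigr do rewrite swapK; rewrite one.
Qed.

(* Exchanging the colors of the two ends of [e] flips the sign of [e]. *)
Lemma sum_signed_disjoint e e' : ~~ touch e e' ->
  \sum_(C : coloring) \sum_q signed C q e * signed C q e' = 0 :> R.
Proof.
move=> ee'; set Z := LHS.
suff : Z = - Z by lra.
pose t (C : coloring) : coloring := [ffun x => C (tperm e.1 e.2 x)].
have tK : involutive t by move=> C; apply/ffunP => x; rewrite !ffunE tpermK.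
rewrite {1}/Z (reindex_inj (inv_inj tK)) /= -sumrN; apply: eq_bigr => C _.
rewrite -sumrN; apply: eq_bigr => q _; rewrite -mulNr; congr (_ * _).
  rewrite /signed /color_pair !ffunE tpermL tpermR opprB.
  by congr (_%:R - _%:R); rewrite /swap /= !xpair_eqE /= andbC; case: q.
move: ee'; rewrite /touch !inE !negb_or => /andP[/andP[n1 n2] /andP[n3 n4]].
by rewrite /signed /color_pair !ffunE !tpermD // eq_sym.
Qed.

Lemma sum_imbalance :
  \sum_(C : coloring) \sum_q imbalance C q ^+ 2 <=
  #|{: coloring}|%:R * (8 * h%:R * #|edges H|%:R).
Proof.
have -> : \sum_(C : coloring) \sum_q imbalance C q ^+ 2 =
    \sum_(e in edges H) \sum_(e' in edges H)
      \sum_(C : coloring) \sum_q signed C q e * signed C q e'.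
  transitivity (\sum_(C : coloring) \sum_q \sum_(e in edges H)
      \sum_(e' in edges H) signed C q e * signed C q e').
    apply: eq_bigr => C _; apply: eq_bigr => q _.
    rewrite expr2 /imbalance mulr_suml; apply: eq_bigr => e _.
    by rewrite mulr_sumr.
  under eq_bigr do rewrite exchange_big /=.
  rewrite exchange_big /=; apply: eq_bigr => e _.
  under eq_bigr do rewrite exchange_big /=.
  by rewrite exchange_big.
rewrite [leRHS](_ : _ = \sum_(e in edges H) #|{: coloring}|%:R * (8 * h%:R)); last first.
  by rewrite sumr_const -mulr_natr; ring.
apply: ler_sum => e _; rewrite (bigID (touch e)) /= [X in _ + X]big1 ?addr0; last first.
  by move=> e' /andP[_]; exact: sum_signed_disjoint.
apply: le_trans (_ : \sum_(e' in edges H | touch e e') #|{: coloring}|%:R * 2 <= _).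
  apply: ler_sum => e' _.
  rewrite [leRHS](_ : _ = \sum_(C : coloring) 2); last by rewrite sumr_const -[RHS]mulr_natl.
  apply: ler_sum => C _; apply: le_trans (ler_norm _) _.
  apply: le_trans (ler_norm_sum _ _ _) (le_trans _ (sum_signed C e)).
  by apply: ler_sum => q _; rewrite normrM ler_piMr // signed_le1.
rewrite sumr_const -[leLHS]mulr_natl mulrCA ler_wpM2l //.
rewrite (_ : 8 * h%:R = (4 * h)%:R * 2); last by rewrite natrM; ring.
rewrite ler_wpM2r // ler_nat; apply: leq_trans (card_touch e).
by apply: subset_leq_card; apply/subsetP => e'; rewrite !inE => /andP[].
Qed.

Lemma exists_balanced_coloring : (0 < k)%N -> (0 < h)%N ->
  exists C : coloring, [/\ (k * mono C <= 2 * #|edges H|)%N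
    & \sum_q imbalance C q ^+ 2 <= 16 * h%:R * #|edges H|%:R].
Proof.
move=> k0 h0; pose Phi (C : coloring) : R :=
  8 * h%:R * (k * mono C)%:R + \sum_q imbalance C q ^+ 2.
pose C0 : coloring := [ffun=> Ordinal k0].
case: (arg_minP Phi (erefl true : predT C0)) => C _ minC.
have F0 : 0 < #|{: coloring}|%:R :> R by rewrite ltr0n; apply/card_gt0P; exists C0.
have PhiC : Phi C <= 16 * h%:R * #|edges H|%:R.
  rewrite -(ler_pM2l F0); apply: le_trans (_ : \sum_C' Phi C' <= _).
    rewrite mulr_natl -sumr_const; apply: ler_sum => C' _; exact: minC.
  rewrite big_split /= -mulr_sumr -natr_sum -big_distrr /=.
  have := sum_mono; rewrite -(ler_nat R) natrM => le1.
  have := sum_imbalance.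
  have : 0 <= 8 * h%:R :> R by rewrite mulr_ge0.
  move=> h8 le2; have := ler_wpM2l h8 le1; lra.
have D0 : 0 <= \sum_q imbalance C q ^+ 2 by apply: sumr_ge0 => q _; exact: sqr_ge0.
have h0' : 0 < h%:R :> R by rewrite ltr0n.
exists C; split; last first.
  apply: le_trans PhiC; rewrite lerDr; apply: mulr_ge0 => //; exact: mulr_ge0.
rewrite -(ler_nat R) [leRHS]natrM -(ler_pM2l (_ : 0 < 8 * h%:R)) ?mulr_gt0 //.
move: PhiC; rewrite /Phi; lra.
Qed.

End Average.
End RandomColoring.

Lemma edges_le_sqr h (H : digraph h) : (#|edges H| <= h * h)%N.
Proof. by apply: leq_trans (max_card _) _; rewrite card_prod card_ord. Qed.

Lemma order_le_edges h (H : digraph h) : no_isolated H -> (h <= 2 * #|edges H|)%N.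
Proof.
move=> iso; have sub : [set: 'I_h] \subset [set e.1 | e in edges H] :|: [set e.2 | e in edges H].
  apply/subsetP => i _; have [j /orP[ij|ji]] := iso i; rewrite inE; apply/orP.
    by left; apply/imsetP; exists (i, j).
  by right; apply/imsetP; exists (j, i).
have := leq_trans (subset_leq_card sub) (leq_card_setU _ _).
rewrite cardsT card_ord => /leq_trans; apply; rewrite mul2n -addnn.
by apply: leq_add; apply: leq_imset_card.
Qed.

Section Approximation.
Variables (R : realType) (h : nat) (H : digraph h).

Lemma skewness_le_coloring k (C : {ffun 'I_h -> 'I_k}) : (k <= h)%N ->
  2 * (skewness H)%:R <= #|edges H|%:R + 2 * (mono H C)%:R +
    \sum_q `|imbalance R H C q|.
Proof.
move=> kh; pose C0 : {ffun 'I_h -> 'I_h} := [ffun i => widen_ord kh (C i)].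
apply: le_trans (_ : 2 * (skewness_col H C0)%:R <= _).
  by rewrite ler_wpM2l // ler_nat skewness_le.
have [|p pC maxp] := @eq_bigmax_cond _ (respects C0)
    (fun p => #|edges (left_subgraph H p)|).
  by have [r [_ [rC _ _]]] := respects_rev C0; apply/card_gt0P; exists r.
have -> : skewness_col H C0 = #|edges (left_subgraph H p)| := maxp.
by apply: left_edges_bound pC => i j; rewrite !ffunE.
Qed.

(* With [m = Y ^ 5] and [h = Z ^ 5], about [Y / Z] colors are used. *)
Lemma skewness_approx : (2 <= #|edges H|)%N -> no_isolated H ->
  `|(skewness H)%:R - #|edges H|%:R / 2| <=
    13 * (#|edges H|%:R `^ (4 / 5) * h%:R `^ (1 / 5)) :> R.
Proof.
move=> m2 iso; have hm := order_le_edges iso; have mh := edges_le_sqr H.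
set m := #|edges H| in m2 hm mh *.
have h2 : (2 <= h)%N by case: (h) mh => [|[|]] //; lia.
set Y : R := m%:R `^ (1 / 5); set Z : R := h%:R `^ (1 / 5).
have m0 : 0 < m%:R :> R by rewrite ltr0n; lia.
have h0 : 0 < h%:R :> R by rewrite ltr0n; lia.
have Y0 : 0 < Y by exact: powR_gt0.
have Z0 : 0 < Z by exact: powR_gt0.
have Y5 : Y ^+ 5 = m%:R.
  by rewrite -powR_mulrn ?ltW // -powRrM mul1r mulVf ?powRr1 // ltW.
have Z5 : Z ^+ 5 = h%:R.
  by rewrite -powR_mulrn ?ltW // -powRrM mul1r mulVf ?powRr1 // ltW.
have -> : m%:R `^ (4 / 5) = Y ^+ 4.
  by rewrite -powR_mulrn ?ltW // -powRrM; congr (_ `^ _); field.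
have [Yge0 Zge0] := (ltW Y0, ltW Z0).
have ZY : Z <= 2 * Y.
  rewrite -(@ler_pXn2r R 5) ?nnegrE ?mulr_ge0 // exprMn Y5 Z5.
  apply: le_trans (_ : 2 * m%:R <= _); first by rewrite -natrM ler_nat.
  by rewrite ler_pM2r //; lra.
pose y := Y / Z; have y0 : 0 < y by rewrite divr_gt0.
pose k := (Num.truncn y).+1.
have [ky yk] : k%:R <= 3 * y /\ y <= k%:R.
  have /andP[t1 t2] := truncn_itv (ltW y0).
  have y1 : 1 / 2 <= y by rewrite ler_pdivlMr // ; lra.
  by split; rewrite /k; [rewrite -addn1 natrD; lra | exact: ltW].
have kh : (k <= h)%N.
  have yh : y < h%:R.
    rewrite -(@ltr_pXn2r R 5) ?nnegrE ?divr_ge0 // expr_div_n Y5 Z5 ltr_pdivrMr //.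
    rewrite -natrX -natrM ltr_nat; apply: leq_ltn_trans mh _.
    by rewrite -expnSr; apply: (@ltn_exp2l h 2 6).
  have /andP[t1 t2] := truncn_itv (ltW y0).
  by rewrite /k -(ltr_nat R); apply: le_lt_trans yh.
have [//||C [monoC imbC]] := @exists_balanced_coloring R h H k; first lia.
have := skewness_le_coloring C kh; rewrite -/m.
have mono_le : (mono H C)%:R <= 2 * (Y ^+ 4 * Z).
  rewrite -(ler_pM2l y0); apply: le_trans (_ : 2 * m%:R <= _); last first.
    by rewrite -Y5 /y le_eqVlt; apply/orP; left; apply/eqP; field; rewrite gt_eqF.
  apply: le_trans (_ : (k * mono H C)%:R <= _); first by rewrite natrM ler_wpM2r.
  by rewrite -natrM ler_nat.
have imb_le : \sum_q `|imbalance R H C q| <= 21 * (Y ^+ 4 * Z).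
  (* AM-GM with the weight [t]: [a <= t / 2 + a ^ 2 / (2 t)]. *)
  pose t := Y ^+ 2 * Z ^+ 3; have t0 : 0 < t by rewrite mulr_gt0 ?exprn_gt0.
  apply: le_trans (_ : \sum_(q : 'I_k * 'I_k) (t / 2 + imbalance R H C q ^+ 2 / (2 * t)) <= _).
    apply: ler_sum => q _; rewrite -(real_normK (num_real (imbalance R H C q))).
    set a := `|_|; rewrite -subr_ge0.
    rewrite (_ : _ - a = (t - a) ^+ 2 / (2 * t)); last by field; rewrite gt_eqF.
    by rewrite divr_ge0 ?sqr_ge0 // mulr_ge0 // ltW.
  rewrite big_split /= -[X in _ + X]mulr_suml sumr_const card_prod card_ord.
  have e1 : t / 2 *+ (k * k) <= (9 / 2) * (Y ^+ 4 * Z).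
    rewrite -mulr_natr natrM.
    apply: le_trans (_ : t / 2 * ((3 * y) * (3 * y)) <= _).
      by rewrite ler_pM2l ?divr_gt0 //; apply: ler_pM.
    by rewrite /t /y le_eqVlt; apply/orP; left; apply/eqP; field; rewrite gt_eqF.
  have e2 : (\sum_q imbalance R H C q ^+ 2) / (2 * t) <= 16 * (Y ^+ 4 * Z).
    rewrite ler_pdivrMr ?mulr_gt0 //; apply: le_trans imbC _.
    rewrite -/m -Y5 -Z5 /t.
    rewrite (_ : 16 * _ * _ = 16 * (Y ^+ 5 * Z ^+ 4) * Z); last ring.
    rewrite [leRHS](_ : _ = 16 * (Y ^+ 5 * Z ^+ 4) * (2 * Y)); last ring.
    by rewrite ler_pM2l // mulr_gt0 // mulr_gt0 // exprn_gt0.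
  apply: le_trans (lerD e1 e2) _; have : 0 < Y ^+ 4 * Z by rewrite mulr_gt0 ?exprn_gt0.
  lra.
have : m%:R <= 2 * (skewness H)%:R :> R by rewrite -natrM ler_nat skewness_ge.
set P := Y ^+ 4 * Z in mono_le imb_le *; move=> s1 s2.
rewrite ler_norml; apply/andP; split; last lra.
have : 0 < P by rewrite mulr_gt0 ?exprn_gt0.
lra.
Qed.

End Approximation.

(** * Copies of a digraph in the random digraph *)

Section RandomDigraphMeasure.
Variables (R : realType) (n : nat) (q : R).

Definition edge_weight (e : 'I_n * 'I_n) : R := if e.1 != e.2 then q else 0.

Lemma expect_digraph (F : {set 'I_n * 'I_n} -> R) :
  expect edge_weight F = \sum_(G : digraph n) F (edges G) * digraph_weight q G.
Proof.
pose loopless (S : {set 'I_n * 'I_n}) := [forall i, (i, i) \notin S].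
rewrite /expect (bigID loopless) /= [X in _ + X]big1 ?addr0; last first.
  move=> S /forallPn[i]; rewrite negbK => iS.
  by rewrite (bigD1 (i, i)) //= iS /edge_weight /= eqxx mul0r mulr0.
rewrite (reindex_omap (@edges n) insub) /=; last first.
  by move=> S lS; rewrite insubT.
apply: eq_big => [G|G _]; first by rewrite valK eqxx andbT [LHS]digraph_loopless.
congr (_ * _); rewrite /digraph_weight [LHS](bigID (fun e => e.1 != e.2)) /=.
rewrite [X in _ * X]big1 ?mulr1; last first.
  move=> [i j]; rewrite negbK /edge_weight /= => /eqP ->.
  by have /forallP/(_ j)/negPf -> := digraph_loopless G; rewrite eqxx subr0.
by apply: eq_bigr => e ne; rewrite /edge_weight ne.
Qed.

Hypothesis q01 : 0 <= q <= 1.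

Lemma edge_weight01 e : 0 <= edge_weight e <= 1.
Proof. by rewrite /edge_weight; case: ifP => // _; rewrite lexx ler01. Qed.

Lemma digraph_weight_ge0 (G : digraph n) : 0 <= digraph_weight q G.
Proof. by apply: prodr_ge0 => e _; case: ifP => _; move: q01; lra. Qed.

Lemma sum_digraph_weight : \sum_(G : digraph n) digraph_weight q G = 1.
Proof.
rewrite -[RHS](expect_cst edge_weight) expect_digraph.
by apply: eq_bigr => G _; rewrite mul1r.
Qed.

Lemma digraph_prob_le1 (A : digraph n -> Prop) : digraph_prob q A <= 1.
Proof.
rewrite -sum_digraph_weight [leRHS](bigID (fun G => `[< A G >])) /= lerDl.
by apply: sumr_ge0 => G _; exact: digraph_weight_ge0.
Qed.

Lemma digraph_prob_ge (A : digraph n -> Prop) (bad : {set 'I_n * 'I_n} -> bool) :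
  (forall G, ~~ bad (edges G) -> A G) ->
  1 - expect edge_weight (fun S => (bad S)%:R) <= digraph_prob q A.
Proof.
move=> badA; rewrite lerBlDr -[leLHS]sum_digraph_weight (bigID (fun G => `[< A G >])) /=.
rewrite lerD2l expect_digraph [leRHS](bigID (fun G => `[< A G >])) /= -[leLHS]add0r.
apply: lerD.
  by apply: sumr_ge0 => G _; apply: mulr_ge0 => //; exact: digraph_weight_ge0.
apply: ler_sum => G /asboolPn nA; case bG : (bad G); first by rewrite mul1r.
by case: nA; apply: badA; rewrite bG.
Qed.

End RandomDigraphMeasure.

Section TransversalCopies.
Variables (R : realType) (h n : nat) (H : digraph h).

Definition inner_edges (W : {set 'I_h}) : {set 'I_h * 'I_h} :=
  [set e in edges H | (e.1 \in W) && (e.2 \in W)].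

Definition ffun_copy (f : {ffun 'I_h -> 'I_n}) := copy_edges H f.

Definition transversals (V : 'I_h -> {set 'I_n}) : {pred {ffun 'I_h -> 'I_n}} :=
  family (fun i => mem (V i)).

Definition blocks (N : nat) (V : {ffun 'I_h -> {set 'I_n}}) : bool :=
  [forall i, #|V i| == N] && [forall i, forall j, (i != j) ==> [disjoint V i & V j]].

Definition no_transversal_copy V (S : {set 'I_n * 'I_n}) : bool :=
  [forall f : {ffun 'I_h -> 'I_n}, (f \in transversals V) ==> ~~ (copy_edges H f \subset S)].

Section FixedBlocks.
Variables (N : nat) (V : {ffun 'I_h -> {set 'I_n}}).
Hypothesis VN : blocks N V.

Let cardV i : #|V i| = N.
Proof. by have /andP[/forallP/(_ i)/eqP] := VN. Qed.

Lemma transversal_inj f g i j : f \in transversals V -> g \in transversals V ->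
  f i = g j -> i = j.
Proof.
move=> /familyP/(_ i) fi /familyP/(_ j) gj e; apply/eqP; apply: contraT => ij.
have /andP[_ /forallP/(_ i)/forallP/(_ j)] := VN; rewrite ij /= => /disjointFr/(_ fi).
by rewrite e gj.
Qed.

Lemma card_copy_edges (f : 'I_h -> 'I_n) : injective f -> #|copy_edges H f| = #|edges H|.
Proof.
move=> fI; apply: card_imset => -[a b] [c d] /= [] /fI -> /fI -> //.
Qed.

Lemma card_agree f (W : {set 'I_h}) : f \in transversals V ->
  (#|[set g in transversals V | [set i | f i == g i] == W]| <= N ^ (h - #|W|))%N.
Proof.
move=> fV.
pose F i : {set 'I_n} := if i \in W then [set f i] else V i.
apply: leq_trans (_ : #|family (fun i => mem (F i))| <= _)%N.
  apply: subset_leq_card; apply/subsetP => g; rewrite !inE => /andP[gV /eqP eW].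
  apply/familyP => i; rewrite /F -eW inE; case: eqP => [->|_]; first by rewrite inE.
  by have /familyP := gV; apply.
rewrite card_family foldrE big_image /=.
rewrite (bigID (fun i => i \in W)) /= big1 ?mul1n; last first.
  by move=> i iW; rewrite /F iW cards1.
rewrite (eq_bigr (fun=> N)) => [|i iW]; last by rewrite /F (negPf iW) cardV.
rewrite prod_nat_const; apply: eq_leq; congr (_ ^ _)%N.
have e : (#|W| + #|[predC W]| = h)%N by rewrite cardC card_ord.
transitivity #|[predC W]|; first exact: eq_card.
by rewrite -[X in (X - _)%N]e addKn.
Qed.

Lemma card_transversals : #|transversals V| = (N ^ h)%N.
Proof.
rewrite /transversals card_family foldrE big_image /= (eq_bigr (fun=> N)) => [|i _].
  by rewrite prod_nat_const card_ord.
exact: cardV.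
Qed.

Variables (q M : R).
Hypotheses (q0 : 0 < q) (q1 : q <= 1) (M0 : 0 < M).
Hypothesis dense : forall W : {set 'I_h}, inner_edges W != set0 ->
  M <= N%:R ^+ #|W| * q ^+ #|inner_edges W|.
Hypothesis H0 : edges H != set0.

Let mu : R := N%:R ^+ h * q ^+ #|edges H|.

Lemma inner_edgesT : inner_edges [set: 'I_h] = edges H.
Proof. by apply/setP => e; rewrite !inE !andbT. Qed.

Lemma M_le_mu : M <= mu.
Proof.
by have := dense (W := [set: 'I_h]); rewrite inner_edgesT cardsT card_ord; apply.
Qed.

Lemma pweight_union f g : f \in transversals V -> g \in transversals V ->
  meet ffun_copy f g ->
  inner_edges [set i | f i == g i] != set0 /\
  pweight (edge_weight q) (copy_edges H f :|: copy_edges H g) <=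
    q ^+ (2 * #|edges H| - #|inner_edges [set i | f i == g i]|).
Proof.
move=> fV gV; set W := [set i | _].
have fI : injective f := fun i j => transversal_inj fV fV.
have gI : injective g := fun i j => transversal_inj gV gV.
have sub : copy_edges H f :&: copy_edges H g \subset
    [set (f e.1, f e.2) | e in inner_edges W].
  apply/subsetP => x; rewrite inE => /andP[/imsetP[e eH ->] /imsetP[e' e'H [e1 e2]]].
  have e1' := transversal_inj fV gV e1; have e2' := transversal_inj fV gV e2.
  by apply/imsetP; exists e => //; rewrite !inE eH e1 e2 e1' e2' !eqxx.
rewrite /meet /= -setI_eq0 => /set0Pn[x /(subsetP sub)/imsetP[e eW _]].
split; first by apply/set0Pn; exists e.
rewrite /pweight (eq_bigr (fun=> q)) => [|y]; last first.
  rewrite inE /edge_weight => /orP[] /imsetP[[i j] ij ->] /=; rewrite inj_eq //;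
  by rewrite (edge_neq ij).
rewrite prodr_const; apply: ler_wiXn2l => //; first exact: ltW.
rewrite cardsU !card_copy_edges // addnn mul2n; apply: leq_sub2l.
apply: leq_trans (subset_leq_card sub) _; exact: leq_imset_card.
Qed.

Lemma sum_meeting_pairs :
  \sum_(f in transversals V) \sum_(g in transversals V |
      meet ffun_copy f g)
      pweight (edge_weight q) (copy_edges H f :|: copy_edges H g) <=
  2 ^+ h * mu ^+ 2 / M.
Proof.
have q_ge0 := ltW q0; have M_ge0 := ltW M0.
have N0 : 0 < N%:R :> R.
  rewrite lt0r ler0n andbT; apply/negP => /eqP N0.
  have := lt_le_trans M0 M_le_mu; rewrite /mu N0.
  have /set0Pn[[i _] _] := H0.
  by rewrite expr0n (_ : h == 0%N = false) ?mul0r ?ltxx //; case: (h) i => // -[].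
have pair_le f : f \in transversals V ->
    \sum_(g in transversals V | meet ffun_copy f g)
      pweight (edge_weight q) (copy_edges H f :|: copy_edges H g) <=
    2 ^+ h * (N%:R ^+ h * (q ^+ #|edges H|) ^+ 2 / M).
  move=> fV; pose agree (g : {ffun 'I_h -> 'I_n}) := [set i | f i == g i].
  rewrite (partition_big agree (fun W => inner_edges W != set0)) /=; last first.
    by move=> g /andP[gV fg]; have [] := pweight_union fV gV fg.
  apply: le_trans (_ : \sum_(W : {set 'I_h}) (N%:R ^+ h * (q ^+ #|edges H|) ^+ 2 / M) <= _);
    last first.
    rewrite sumr_const -[leLHS]mulr_natl -cardsT -powersetT.
    by rewrite card_powerset cardsT card_ord natrX.
  rewrite big_mkcond /=; apply: ler_sum => W _; case: ifP => [W0|_]; last first.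
    by rewrite divr_ge0 ?mulr_ge0 ?sqr_ge0 ?exprn_ge0.
  set eW := #|inner_edges W|.
  have eWm : (eW <= #|edges H|)%N.
    by apply: subset_leq_card; apply/subsetP => e; rewrite inE => /andP[].
  have Wh : (#|W| <= h)%N by rewrite -[leqRHS]card_ord max_card.
  apply: le_trans (_ : \sum_(g in transversals V | agree g == W) q ^+ (2 * #|edges H| - eW) <= _).
    rewrite [leRHS]big_mkcondr /= [leLHS](_ : _ = \sum_(g in transversals V)
      if meet ffun_copy f g && (agree g == W) then
        pweight (edge_weight q) (copy_edges H f :|: copy_edges H g) else 0).
      apply: ler_sum => g gV; case: (boolP (meet _ _ _)) => [fg|_] /=.
        case: eqP => // Wg; have [_] := pweight_union fV gV fg.
        by rewrite /eW -Wg.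
      by case: ifP => // _; rewrite exprn_ge0 // ltW.
    by rewrite -big_mkcondr; apply: eq_bigl => g; rewrite andbA.
  rewrite sumr_const -[leLHS]mulr_natl.
  apply: le_trans (_ : N%:R ^+ (h - #|W|) * q ^+ (2 * #|edges H| - eW) <= _).
    rewrite ler_wpM2r ?exprn_ge0 // -natrX ler_nat.
    by apply: leq_trans (card_agree W fV); rewrite cardsE.
  rewrite ler_pdivlMr //.
  have fac_ge0 : 0 <= N%:R ^+ (h - #|W|) * q ^+ (2 * #|edges H| - eW).
    by rewrite mulr_ge0 ?exprn_ge0.
  apply: le_trans (ler_wpM2l fac_ge0 (dense W0)) _; rewrite -/eW.
  by rewrite mulrACA -!exprD -exprM !subnK ?[(#|edges H| * 2)%N]mulnC //; lia.
apply: le_trans (ler_sum _ pair_le) _.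
rewrite sumr_const card_transversals -[leLHS]mulr_natl natrX /mu le_eqVlt.
by apply/orP; left; apply/eqP; field; rewrite gt_eqF.
Qed.

Lemma no_transversal_copy_prob :
  expect (edge_weight q) (fun S => (no_transversal_copy V S)%:R) <=
  expR (- (M / 2 ^+ h.+2)).
Proof.
have mu0 : 0 < mu := lt_le_trans M0 M_le_mu.
have q01 : 0 <= q <= 1 by rewrite ltW.
have h0 : 0 < 2 ^+ h.+1 :> R by rewrite exprn_gt0.
have h1 : 1 <= 2 ^+ h.+1 :> R by rewrite exprn_ege1 // ler1n.
pose s := M / (2 ^+ h.+1 * mu).
have s01 : 0 <= s <= 1.
  apply/andP; rewrite /s; split.
    by apply: ltW; apply: divr_gt0 => //; apply: mulr_gt0.
  rewrite ler_pdivrMr; last exact: mulr_gt0.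
  rewrite mul1r.
  by apply: le_trans M_le_mu _; rewrite ler_peMl // ltW.
pose A (f : {f : {ffun 'I_h -> 'I_n} | f \in transversals V}) := copy_edges H (val f).
apply: le_trans (_ : expect (edge_weight q) (fun S => [forall f, ~~ (A f \subset S)]%:R) <= _).
  apply: le_expect => [e|S]; first exact: edge_weight01.
  rewrite ler_nat; case: (boolP (no_transversal_copy _ _)) => // /forallP nS.
  rewrite (_ : [forall _, _]) //; apply/forallP => f.
  by have /implyP := nS (val f); apply; exact: valP f.
apply: le_trans (janson A (edge_weight01 q01) s01) _.
rewrite ler_expR lerN2.
have -> : \sum_f pweight (edge_weight q) (A f) = mu.
  rewrite -(big_sub (transversals V) (fun f => pweight (edge_weight q) (copy_edges H f))).
  rewrite (eq_bigr (fun=> q ^+ #|edges H|)) => [|f fV].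
    by rewrite sumr_const card_transversals -mulr_natl natrX.
  have fI : injective f := fun i j => transversal_inj fV fV.
  rewrite -(card_copy_edges fI) /pweight -prodr_const; apply: eq_bigr => y.
  by rewrite /edge_weight => /imsetP[[i j] ij ->]; rewrite /= inj_eq // (edge_neq ij).
have D : \sum_i \sum_(j | meet A i j) pweight (edge_weight q) (A i :|: A j) <=
    2 ^+ h * mu ^+ 2 / M.
  apply: le_trans sum_meeting_pairs; rewrite le_eqVlt; apply/orP; left; apply/eqP.
  rewrite [RHS]big_sub; apply: eq_bigr => f _.
  by rewrite [RHS]big_sub_cond.
apply: le_trans (_ : s * mu - s ^+ 2 * (2 ^+ h * mu ^+ 2 / M) <= _).
  rewrite le_eqVlt; apply/orP; left; apply/eqP; rewrite /s !exprS.
  by field; rewrite !gt_eqF // exprn_gt0.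
by rewrite lerD2l lerN2 ler_wpM2l ?sqr_ge0.
Qed.

End FixedBlocks.
End TransversalCopies.

Section UnionBound.
Variables (R : realType) (h n : nat) (H : digraph h) (N : nat).

Definition some_block_free (S : {set 'I_n * 'I_n}) : bool :=
  [exists V : {ffun 'I_h -> {set 'I_n}}, blocks N V && no_transversal_copy H V S].

Lemma some_block_free_prob (q M : R) : 0 < q <= 1 -> 0 < M ->
  (forall W : {set 'I_h}, inner_edges H W != set0 ->
    M <= N%:R ^+ #|W| * q ^+ #|inner_edges H W|) -> edges H != set0 ->
  expect (edge_weight q) (fun S => (some_block_free S)%:R) <=
  2 ^+ (n * h) * expR (- (M / 2 ^+ h.+2)).
Proof.
move=> /andP[q0 q1] M0 dense H0.
have q01 : 0 <= q <= 1 by rewrite ltW.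
apply: le_trans (_ : expect (edge_weight q) (fun S => \sum_(V | blocks N V)
    (no_transversal_copy H V S)%:R) <= _).
  apply: le_expect => [e|S]; first exact: edge_weight01.
  rewrite /some_block_free; case: existsP => [[V /andP[bV nV]]|_]; last exact: sumr_ge0.
  by rewrite (bigD1 V) //= nV lerDl sumr_ge0.
rewrite expect_sum.
apply: le_trans (_ : \sum_(V : {ffun 'I_h -> {set 'I_n}}) expR (- (M / 2 ^+ h.+2)) <= _).
  rewrite big_mkcond /=; apply: ler_sum => V _; case: ifP => [bV|_]; last exact: expR_ge0.
  exact: (no_transversal_copy_prob bV q0 q1 M0 dense H0).
rewrite sumr_const -[leLHS]mulr_natl card_ffun card_ord -cardsT -powersetT.
by rewrite card_powerset cardsT card_ord -expnM natrX.
Qed.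

Lemma has_skew_copies_of_blocks (c : R) (G : digraph n) :
  ~~ some_block_free (edges G) ->
  (forall t : nat, t%:R <= c * log2 (n%:R : R) ->
    (h * (h * N * 2 ^ (h * h * t)) <= n)%N) ->
  has_skew_copies H c G.
Proof.
move=> nbad large X /large Xn.
pose C := [arg min_(C < [ffun i => i] : {ffun 'I_h -> 'I_h}) skewness_col H C]%N.
have [U [V [VU cV dV sep]]] := separated_blocks C Xn.
have bV : blocks N [ffun i => V i].
  apply/andP; split; first by apply/forallP => i; rewrite ffunE cV.
  by apply/forallP => i; apply/forallP => j; apply/implyP; rewrite !ffunE; apply: dV.
move/existsPn: nbad => /(_ [ffun i => V i]); rewrite bV /=.
case/forallPn => f; rewrite negb_imply negbK => /andP[fV fG].
have fI : injective f := fun i j => transversal_inj bV fV fV.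
exists f; first by split.
move=> p pX; apply: (@copy_left_edges _ _ H C f U) => //.
  move=> i; apply: (subsetP (VU i)); have /familyP/(_ i) := fV.
  by rewrite ffunE.
by move=> c' d cd; apply: sep.
Qed.

End UnionBound.

Section Density.
Variables (R : realType) (h : nat) (H : digraph h).

Lemma inner_edges_gt1 (W : {set 'I_h}) : inner_edges H W != set0 -> (2 <= #|W|)%N.
Proof.
case/set0Pn => -[i j]; rewrite !inE /= => /and3P[ij iW jW].
by apply/card_gt1P; exists i, j; split=> //; exact: edge_neq ij.
Qed.

Lemma inner_edges_le (W : {set 'I_h}) : inner_edges H W != set0 ->
  #|inner_edges H W|%:R <= arboricity R H * (#|W|%:R - 1).
Proof.
move=> W0; have W2 := inner_edges_gt1 W0.
have W1 : 0 < #|W|%:R - 1 :> R by rewrite subr_gt0 ltr1n.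
rewrite -ler_pdivrMr // /arboricity.
apply: (le_bigmax_cond _ (fun S : {set 'I_h} * {set 'I_h * 'I_h} => _)
  (j := (W, inner_edges H W))).
rewrite /is_subgraph /= W2 andbT; apply/andP; split.
  by apply/subsetP => e; rewrite inE => /andP[].
by apply/subsetP => e; rewrite !inE => /andP[].
Qed.

Lemma arboricity_gt0 : edges H != set0 -> 0 < arboricity R H.
Proof.
move=> H0; have T0 : inner_edges H setT != set0 by rewrite inner_edgesT.
have := inner_edges_le T0; have := inner_edges_gt1 T0.
rewrite -(ltr_nat R) inner_edgesT => T1 le.
rewrite -(pmulr_lgt0 _ (_ : 0 < #|[set: 'I_h]|%:R - 1)) ?subr_gt0 //.
by apply: lt_le_trans le; rewrite ltr0n card_gt0.
Qed.

Lemma dense_inner_edges (a x eps : R) N (W : {set 'I_h}) :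
  eps = (1 - arboricity R H / a) / (2 * h%:R) -> arboricity R H < a ->
  1 <= x -> x `^ (1 - eps) <= N%:R -> inner_edges H W != set0 ->
  x `^ (1 + (1 - arboricity R H / a) / 2) <=
    N%:R ^+ #|W| * (x `^ (- a^-1)) ^+ #|inner_edges H W|.
Proof.
move=> epsE aH x1 xN W0; have W2 := inner_edges_gt1 W0.
have x0 : 0 < x by exact: lt_le_trans x1.
have H0 : edges H != set0.
  by case/set0Pn: W0 => e; rewrite inE => /andP[eH _]; apply/set0Pn; exists e.
have al0 := arboricity_gt0 H0; have a0 : 0 < a := lt_trans al0 aH.
have leW := inner_edges_le W0.
have Wh : (#|W| <= h)%N by have := max_card W; rewrite card_ord.
set th := arboricity R H / a in epsE *.
have th1 : th < 1 by rewrite /th ltr_pdivrMr ?mul1r.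
have h0 : 0 < h%:R :> R by rewrite ltr0n; lia.
apply: le_trans (_ : (x `^ (1 - eps)) ^+ #|W| * (x `^ (- a^-1)) ^+ #|inner_edges H W| <= _);
  last by rewrite ler_wpM2r ?exprn_ge0 ?powR_ge0 // lerXn2r ?nnegrE ?powR_ge0.
rewrite -!powR_mulrn ?powR_ge0 // -!powRrM -powRD; last by apply/implyP => _; rewrite gt_eqF.
apply: ler_powR => //.
have e1 : #|inner_edges H W|%:R / a <= th * (#|W|%:R - 1).
  by rewrite /th mulrAC ler_pM2r ?invr_gt0.
have e2 : eps * #|W|%:R <= (1 - th) / 2.
  rewrite epsE [leRHS](_ : _ = (1 - th) / (2 * h%:R) * h%:R); last by field; rewrite gt_eqF.
  by rewrite ler_wpM2l ?ler_nat // divr_ge0 ?mulr_ge0 // subr_ge0 ltW.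
have e3 : 0 <= (1 - th) * (#|W|%:R - 2).
  by rewrite mulr_ge0 // subr_ge0 ?ler_nat // ltW.
move: e1 e2 e3; set w := #|W|%:R; set e := #|_|%:R; rewrite mulNr [a^-1 * e]mulrC.
lra.
Qed.

End Density.

(** * Asymptotics *)

Section Asymptotics.
Variables (R : realType) (h : nat) (H : digraph h).

Lemma near_ge_powR (b B : R) : 0 < b -> \forall n \near \oo%classic, B <= n%:R `^ b.
Proof.
move=> b0; pose B' := Num.max B 1.
have bN0 : b != 0 by rewrite gt_eqF.
have B0 : 0 <= B' by rewrite le_max ler01 orbT.
near=> n; apply: le_trans (_ : B' <= _); first by rewrite le_max lexx.
rewrite -[leLHS]powRr1 // -[X in _ `^ X <= _](mulVf bN0) powRrM.
apply: ge0_ler_powR; rewrite ?nnegrE ?powR_ge0 //; first exact: ltW.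
by near: n; exact: nbhs_infty_ger.
Unshelve. all: by end_near. Qed.

Lemma aas_ge (q : nat -> R) (A : forall n, digraph n -> Prop) :
  (\forall n \near \oo%classic, 0 <= q n <= 1) ->
  (\forall n \near \oo%classic, 1 - expR (- n%:R) <= digraph_prob (q n) (A n)) ->
  aas q A.
Proof.
move=> q01 Aq; rewrite /aas.
apply: (@squeeze_cvgr _ _ _ _ (fun n => 1 - expR (-1) ^+ n) (fun=> 1)).
- near=> n; apply/andP; split; last by apply: digraph_prob_le1; near: n.
  by rewrite -expRM_natl mulrN1; near: n.
- rewrite -[X in (_ --> X)%classic]subr0; apply: cvgB; first exact: cvg_cst.
  by apply: cvg_expr; rewrite ger0_norm ?expR_ge0 // expR_lt1 oppr_lt0.
- exact: cvg_cst.
Unshelve. all: by end_near. Qed.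

Lemma pow2_le_powR (n k : nat) (b : R) : (0 < n)%N ->
  k%:R <= b * log2 (n%:R : R) -> 2 ^+ k <= n%:R `^ b.
Proof.
move=> n0; rewrite /log2 mulrA ler_pdivlMr ?ln_gt0 ?ltr1n // => kb.
by rewrite -powR_mulrn // /powR !gt_eqF ?ltr0n // ler_expR.
Qed.

Lemma aas_skew_copies (a : R) : edges H != set0 -> arboricity R H < a ->
  exists c : R, 0 < c /\
    aas (fun n => n%:R `^ (- a^-1)) (fun n G => has_skew_copies H c G).
Proof.
move=> H0 aH; have al0 := arboricity_gt0 R H0; have a0 := lt_trans al0 aH.
have h0 : (0 < h)%N by have /set0Pn[[[i ih] j] _] := H0; exact: leq_ltn_trans ih.
have h0R : 0 < h%:R :> R by rewrite ltr0n.
have h1R : 1 <= h%:R :> R by rewrite ler1n.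
pose th := arboricity R H / a.
have th0 : 0 < th by exact: divr_gt0.
have th1 : th < 1 by rewrite /th ltr_pdivrMr ?mul1r.
pose eps : R := (1 - th) / (2 * h%:R); pose delta : R := (1 - th) / 2.
have eps0 : 0 < eps by apply: divr_gt0; rewrite ?subr_gt0 ?mulr_gt0.
have eps1 : eps <= 1 by rewrite ler_pdivrMr ?mulr_gt0 //; lra.
have delta0 : 0 < delta by apply: divr_gt0; rewrite ?subr_gt0.
pose c : R := eps / 2 / (h * h)%:R.
have hh0 : 0 < (h * h)%:R :> R by rewrite ltr0n muln_gt0 h0.
exists c; split; first by do 2! apply: divr_gt0 => //.
have q01 n : (0 < n)%N -> 0 < (n%:R : R) `^ (- a^-1) <= 1.
  move=> n0; rewrite powR_gt0 ?ltr0n //= -[leRHS](powRr0 (n%:R : R)).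
  by apply: ler_powR; rewrite ?ler1n // oppr_le0 invr_ge0 ltW.
apply: aas_ge.
  exists 1%N => // n /= n0; have /andP[q0 ->] := q01 n n0.
  by rewrite ltW.
near=> n.
have n0 : (0 < n)%N by near: n; exists 1%N.
have x1 : 1 <= n%:R :> R by rewrite ler1n.
have x0 : 0 < n%:R :> R by rewrite ltr0n.
have big1 : h.+1%:R * 2 ^+ h.+2 <= n%:R `^ delta :> R by near: n; exact: near_ge_powR.
have big2 : 2 * (h * h)%:R <= n%:R `^ (eps / 2) :> R.
  by near: n; apply: near_ge_powR; exact: divr_gt0.
pose y : R := n%:R `^ (1 - eps); pose N := (Num.truncn y).+1.
have y0 : 0 <= y by exact: powR_ge0.
have y1 : 1 <= y.
  by rewrite -[leLHS](powRr0 (n%:R : R)); apply: ler_powR; rewrite ?subr_ge0.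
have /andP[trunc_le lt_trunc] := truncn_itv y0.
have N_le : N%:R <= 2 * y by rewrite /N -addn1 natrD; lra.
pose M : R := n%:R `^ (1 + delta).
have M0 : 0 < M by exact: powR_gt0.
have dense (W : {set 'I_h}) : inner_edges H W != set0 ->
    M <= N%:R ^+ #|W| * (n%:R `^ (- a^-1)) ^+ #|inner_edges H W|.
  by move=> W0; apply: (@dense_inner_edges _ _ _ _ _ eps) => //; exact: ltW.
have q01n := q01 n n0.
have prob_bad : expect (@edge_weight R n (n%:R `^ (- a^-1)))
    (fun S => (some_block_free H N S)%:R) <= expR (- n%:R).
  apply: le_trans (some_block_free_prob n q01n M0 dense H0) _.
  apply: le_trans (_ : expR (n * h)%:R * expR (- (M / 2 ^+ h.+2)) <= _).
    rewrite ler_wpM2r ?expR_ge0 // -[(n * h)%:R]mulr1 expRM_natl.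
    rewrite lerXn2r ?nnegrE ?expR_ge0 //.
    by have := @expR_ge1Dx R 1; lra.
  rewrite -expRD ler_expR.
  have : n%:R * h.+1%:R <= M / 2 ^+ h.+2.
    rewrite ler_pdivlMr ?exprn_gt0 // /M powRD; last by apply/implyP => _; rewrite gt_eqF.
    by rewrite powRr1 // -mulrA ler_pM2l.
  rewrite natrM -[h.+1]addn1 natrD; lra.
apply: le_trans (_ : 1 - expect (@edge_weight R n (n%:R `^ (- a^-1)))
    (fun S => (some_block_free H N S)%:R) <= _); first by rewrite lerD2l lerN2.
apply: digraph_prob_ge => [|G nbad]; first by case/andP: q01n => /ltW -> ->.
 apply: has_skew_copies_of_blocks nbad _ => t tc.
have pw : 2 ^+ (h * h * t) <= n%:R `^ (eps / 2) :> R.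
  apply: pow2_le_powR => //; rewrite natrM; apply: le_trans (ler_wpM2l (ltW hh0) tc) _.
  by rewrite /c mulrA [_%:R * _]mulrC divfK // gt_eqF.
rewrite -(ler_nat R) !natrM natrX.
have yE : y * n%:R `^ (eps / 2) * n%:R `^ (eps / 2) = n%:R.
  rewrite /y -!powRD; try by apply/implyP => _; rewrite gt_eqF.
  by rewrite (_ : 1 - eps + eps / 2 + eps / 2 = 1) ?powRr1 //; lra.
rewrite -[leRHS]yE.
have P0 : 0 <= n%:R `^ (eps / 2) :> R by exact: powR_ge0.
apply: le_trans (_ : 2 * (h * h)%:R * (y * n%:R `^ (eps / 2)) <= _); last first.
  by rewrite [leRHS]mulrC ler_wpM2r // mulr_ge0.
rewrite (_ : _ * _ = (h * h)%:R * (N%:R * 2 ^+ (h * h * t))); last by rewrite natrM; ring.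
rewrite [leRHS](_ : _ = (h * h)%:R * ((2 * y) * n%:R `^ (eps / 2))); last by ring.
by rewrite ler_pM2l // ler_pM.
Unshelve. all: by end_near. Qed.

End Asymptotics.

Theorem theorem4 (R : realType) :
  exists K : R, 0 < K /\
  forall (h : nat) (H : digraph h),
    (2 <= #|edges H|)%N -> no_isolated H -> dag H -> ~ rooted_star H ->
    let m := #|edges H| in
    [/\ `|(skewness H)%:R - m%:R / 2| <= K * (m%:R `^ (4 / 5) * h%:R `^ (1 / 5)),
        (skewness H < m)%N
      & forall a : R, arboricity R H < a ->
        exists c : R, 0 < c /\
          aas (fun n => n%:R `^ (- a^-1)) (fun n G => has_skew_copies H c G)].
Proof.
exists 13; split=> // h H m2 iso _ nstar m; split.
- exact: skewness_approx.
- exact: skewness_lt.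
- by move=> a; apply: aas_skew_copies; rewrite -card_gt0; apply: leq_trans m2.
Qed.
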